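(* Let $(X,d)$ be a nonempty compact metric space and let $T:X\to X$ be a one-to-one and continuous mapping. Then every $T$-contractive function $S:X\to X$ has a unique fixed point. Moreover, for any $x_0\in X$ the sequence of iterates $\{S^n x_0\}$ converges to this fixed point.
   Context: Let $(X,d)$ be a metric space and $T,S:X\to X$ two functions. $S$ is called $T$-contractive if for every $x,y\in X$ such that $Tx\ne Ty$ one has $d(TSx,TSy)<d(Tx,Ty)$, where $TSx=T(S(x))$. $S$ is not assumed to be continuous. $S^n$ denotes the $n$-fold composition of $S$ with itself. *)

(* Defs.v *)
From mathcomp Require Import all_boot all_order all_algebra.
From mathcomp Require Import all_classical all_reals all_analysis.

Set Implicit Arguments.
Unset Strict Implicit.
Unset Printing Implicit Defensive.

Import Order.TTheory GRing.Theory Num.Theory.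

Local Open Scope ring_scope.

Definition T_contractive (R : realType) (X : metricType R) (T S : X -> X) : Prop :=
  forall x y : X, T x <> T y -> mdist (T (S x)) (T (S y)) < mdist (T x) (T y).

(* Main.v *)
Require Import Defs.
From mathcomp Require Import all_boot all_order all_algebra.
From mathcomp Require Import all_classical all_reals all_analysis.
From mathcomp Require Import lra.

Import Order.TTheory GRing.Theory Num.Theory.
Import numFieldNormedType.Exports.

(** Put [rho x y = mdist (T x) (T y)].  As [T] is injective, [rho] is a metric
    on [X], and a [T]-contractive map is one that strictly decreases the
    [rho]-distance between distinct points; so the theorem is Edelstein's
    fixed point theorem for [rho].  Compactness makes [T] a homeomorphism onto
    its image ([cvg_of_cvg_image]), hence [rho] induces the original topology.
    In particular [S], which is 1-Lipschitz for [rho], is continuous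
    ([T_contractive_continuous]).

    The continuous function [x |-> rho x (S x)] attains its minimum; at a point
    that is not fixed, moving to [S x] would decrease it, so the minimum point
    is fixed ([T_contractive_fixpoint]).  Two distinct fixed points would be
    strictly closer to each other than they are.

    Along an orbit, the [rho]-distance to the fixed point [p] is
    nonincreasing.  If the orbit accumulated at some [z != p], it would come so
    close to [z] that its next point lies in a [rho]-ball around [p] of radius
    [c < rho z p]; it could never leave that ball again, and so never return
    near [z] ([T_contractive_cluster]).  Thus [p] is the only cluster point, and
    in a compact space this is convergence ([compact_cvg_of_cluster]). *)

Local Open Scope classical_set_scope.
Local Open Scope ring_scope.

(** The cluster set is nonempty by compactness, so a bound on it by one point
    already determines it. *)
Lemma compact_cvg_of_cluster (X : topologicalType) (F : set_system X) (p : X) :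
  hausdorff_space X -> compact [set: X] -> ProperFilter F ->
  (forall z, cluster F z -> z = p) -> F --> p.
Proof.
move=> hX cX FF Fp.
apply: (compact_cluster_set1 hX cX) => //; [exact: filterT|exact: filterT|].
have [q [_ Fq]] := cX F FF filterT.
apply/seteqP; split=> [z /Fp //|_ ->].
by rewrite -(Fp q Fq).
Qed.

(** A continuous injection of a compact space into a Hausdorff space is an
    embedding; in this filter form it lets convergence be tested after applying
    [f]. *)
Lemma cvg_of_cvg_image (X Y : topologicalType) (f : X -> Y) (F : set_system X)
    (p : X) :
  hausdorff_space X -> hausdorff_space Y -> compact [set: X] ->
  injective f -> continuous f -> ProperFilter F ->
  f @ F --> f p -> F --> p.
Proof.
move=> hX hY cX fI fC FF Fp; apply: compact_cvg_of_cluster => // z Fz.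
apply/fI/hY => A B Az Bp.
have [x [Bx Ax]] := Fz _ _ (Fp _ Bp) (fC z _ Az).
by exists (f x).
Qed.

Lemma cvg_mdist (R : realType) (X : metricType R) (I : Type)
    (F : set_system I) (f g : I -> X) (a b : X) :
  Filter F -> f @ F --> a -> g @ F --> b ->
  (fun i => mdist (f i) (g i)) @ F --> mdist a b.
Proof.
move=> FF fa gb; apply/cvgrPdist_lt => e e0.
have e20 : 0 < e / 2 by rewrite divr_gt0.
have fe := metricType_numDomainType.cvgr_dist_lt fa e20.
have ge := metricType_numDomainType.cvgr_dist_lt gb e20.
apply: filterS2 _ (fe FF) (ge FF) => i fi gi.
have := metric_triangle a (f i) b.
have := metric_triangle (f i) (g i) b.
have := metric_triangle (f i) a (g i).
have := metric_triangle a b (g i).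
rewrite (metric_sym (f i) a) (metric_sym (g i) b) => h1 h2 h3 h4.
rewrite ltr_norml; apply/andP; split; lra.
Qed.

Section TContractive.
Context {R : realType} {X : metricType R} {T S : X -> X}.
Hypothesis T_inj : injective T.
Hypothesis S_contr : T_contractive T S.

Lemma T_contractive_lt x y :
  x <> y -> mdist (T (S x)) (T (S y)) < mdist (T x) (T y).
Proof. by move=> xy; apply: S_contr => /T_inj. Qed.

Lemma T_contractive_le x y :
  mdist (T (S x)) (T (S y)) <= mdist (T x) (T y).
Proof.
have [->|/T_contractive_lt/ltW //] := pselect (x = y).
by rewrite !mdistxx.
Qed.

Lemma T_contractive_fixpoint_unique p q : S p = p -> S q = q -> q = p.
Proof.
move=> Sp Sq; apply: contrapT => /T_contractive_lt.
by rewrite Sp Sq ltxx.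
Qed.

Hypothesis X_compact : compact [set: X].
Hypothesis T_cont : continuous T.

(** Contractivity only makes [T \o S] continuous; cancelling [T] uses that it is
    an embedding, hence the compactness of [X]. *)
Lemma T_contractive_continuous : continuous S.
Proof.
move=> x.
apply: (cvg_of_cvg_image _ _ T) => //; [exact: metric_hausdorff..|].
apply/metricType_numDomainType.cvgrPdist_lt => e e0.
apply: filterS (metricType_numDomainType.cvgr_dist_lt (T_cont x) e0) => y.
exact: le_lt_trans (T_contractive_le x y).
Qed.

(** A point that [S] moves is not a minimum of the displacement
    [mdist (T x) (T (S x))], since [S x] has a smaller one. *)
Lemma T_contractive_fixpoint : [set: X] !=set0 -> exists p, S p = p.
Proof.
move=> X0.
have dC : continuous (fun x => mdist (T x) (T (S x))).
  move=> x; apply: cvg_mdist; first exact: T_cont.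
  exact: (continuous_comp (T_contractive_continuous x) (T_cont (S x))).
have [p _ p_min] := compact_EVT_min X0 X_compact (continuous_subspaceT dC).
exists p; apply: contrapT => /nesym/T_contractive_lt.
by rewrite ltNge p_min ?inE.
Qed.

(** The distance [g] to the fixed point never increases along an orbit; a jump
    of [g] from near [g z] to below some [c < g z] can thus happen only once,
    whereas accumulation at [z] would repeat it. *)
Lemma T_contractive_cluster p x0 z :
  S p = p -> cluster ((fun n => iter n S x0) @ \oo) z -> z = p.
Proof.
move=> Sp x_z; apply: contrapT => zp.
pose g y := mdist (T y) (T p).
have gC : continuous g.
  by move=> y; apply: cvg_mdist; [exact: T_cont|exact: cvg_cst].
have g_S y : g (S y) <= g y by rewrite /g -{1}Sp; exact: T_contractive_le.
have gSz : g (S z) < g z by rewrite /g -{1}Sp; exact: T_contractive_lt.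
pose c := (g (S z) + g z) / 2.
have gSz_c : g (S z) < c by rewrite /c; lra.
have c_gz : c < g z by rewrite /c; lra.
have near_lt : nbhs z [set y | g (S y) < c].
  have gSC := continuous_comp (T_contractive_continuous z) (gC (S z)).
  exact: (cvgr_lt _ gSC c gSz_c).
have near_gt : nbhs z [set y | c < g y] by exact: (cvgr_gt _ (gC z) c c_gz).
(* Once the orbit visits [near_lt], it stays in [g < c] from the next step on,
   and so never visits [near_gt] afterwards. *)
have [_ [[n _ <-] gn_c]] : range (fun n => iter n S x0)
    `&` [set y | g (S y) < c] !=set0.
  by apply: (x_z _ _ _ near_lt); exists 0%N => // n _; exists n.
have trapped m : (n < m)%N -> g (iter m S x0) < c.
  move=> /subnK <-; elim: (m - n.+1)%N => [|k IH] //=.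
  exact: le_lt_trans (g_S _) IH.
have near_lt_c : ((fun n => iter n S x0) @ \oo) [set y | g y < c].
  by exists n.+1.
have [y [/= y_lt y_gt]] := x_z _ _ near_lt_c near_gt.
by move: (lt_trans y_lt y_gt); rewrite ltxx.
Qed.

End TContractive.

Theorem theorem2p9 (R : realType) (X : metricType R)
    (X_nonempty : [set: X] !=set0) (X_compact : compact [set: X])
    (T : X -> X) (T_inj : injective T) (T_cont : continuous T)
    (S : X -> X) (S_contr : T_contractive T S) :
  exists p : X,
    [/\ S p = p,
        forall q : X, S q = q -> q = p
      & forall x0 : X, (fun n : nat => iter n S x0) @ \oo --> p].
Proof.
have [p Sp] := T_contractive_fixpoint T_inj S_contr X_compact T_cont X_nonempty.
exists p; split=> // [q|x0].
  exact: (T_contractive_fixpoint_unique T_inj S_contr).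
apply: compact_cvg_of_cluster => // [|z]; first exact: metric_hausdorff.
exact: (T_contractive_cluster T_inj S_contr).
Qed.
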